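(* For a finite bipartite graph $G$ (with bipartition $(X,Y)$) the following are equivalent: (i) $I(G)$ is a comparability graph; (ii) $\overline{G}$ has a $T$-free orientation; (iii) $G$ does not contain an invertible pair; (iv) $G$ does not contain a weak edge-asteroid; (v) $G$ does not contain an edge-asteroid; (vi) $\overline{I(G)}$ does not contain an asteroid.
   Context: Two edges $xy,x'y'$ of $G$ ($x,x'\in X$, $y,y'\in Y$) are independent if they are disjoint and $xy'\notin E(G)$, $x'y\notin E(G)$. $I(G)$ has vertex set $E(G)$, two edges adjacent iff independent; $\overline{I(G)}$ is its complement. A comparability graph is a graph admitting a transitive orientation. An orientation of the complement $\overline{G}$ is a mixed graph in which every non-edge $xy$ of $G$ with $x\in X,y\in Y$ is an undirected edge and every pair of distinct vertices both in $X$ or both in $Y$ is oriented in exactly one direction; it is $T$-free if there are no $x,x'\in X$, $y,y'\in Y$ with $xy,x'y'\notin E(G)$, $xy',x'y\in E(G)$, and arcs $x\to x'$, $y\to y'$. Two walks $a_1\dots a_k$, $b_1\dots b_k$ with $a_1,b_1$ in the same part are congruent if for each $i$ the edges $a_ia_{i+1}$, $b_ib_{i+1}$ are independent; $u,v$ is an invertible pair if there are congruent walks from $u$ to $v$ and from $v$ to $u$. An edge-asteroid is a set of $2k+1$ ($k\ge1$) distinct edges $e_0,\dots,e_{2k}$ such that for each $i$ there is a walk containing both end vertices of $e_{i+k}$ and of $e_{i+k+1}$ and no vertex adjacent to an end vertex of $e_i$ (indices mod $2k+1$); a weak edge-asteroid is the same but the edges $e_0,\dots,e_{2k}$ need not be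 distinct. An asteroid in a graph $H$ is a set of $2k+1$ vertices $v_0,\dots,v_{2k}$ ($k\ge1$) such that for each $i$ there is a path joining $v_{i+k}$ and $v_{i+k+1}$ containing no neighbour of $v_i$ (indices mod $2k+1$). *)

(* Defs.v *)
From mathcomp Require Import all_boot zmodp.

Set Implicit Arguments.
Unset Strict Implicit.
Unset Printing Implicit Defensive.

(* Simple: irreflexivity of [adj] follows from [adj_cross] and
   [part_disjoint]. *)
Record bigraph := Bigraph {
  vertex :> finType;
  adj : rel vertex;
  partX : {set vertex};
  partY : {set vertex};
  adj_sym : symmetric adj;
  part_cover : partX :|: partY = [set: vertex];
  part_disjoint : [disjoint partX & partY];
  adj_cross : forall u v, adj u v ->
    (u \in partX) && (v \in partY) || (u \in partY) && (v \in partX)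
}.

Section AnyGraph.
Variables (W : finType) (H : rel W).

Definition complement : rel W := fun u v => (u != v) && ~~ H u v.

Definition orientation (A : rel W) : Prop :=
  (forall u v, H u v = A u v || A v u) /\ (forall u v, ~~ (A u v && A v u)).

Definition comparability_graph : Prop :=
  exists A : rel W, orientation A /\ transitive A.

(* Walks and paths are nonempty; a single vertex is allowed. *)
Definition is_walk (s : seq W) : bool :=
  if s is a :: p then path H a p else false.

Definition is_path_between (u v : W) (s : seq W) : bool :=
  [&& is_walk s, uniq s, head u s == u & last u s == v].

(* [inZp] reduces an index modulo 2k+1. *)
Definition asteroid (k : nat) (v : 'I_(2 * k).+1 -> W) : Prop :=
  [/\ 0 < k, injective v &
    forall i : 'I_(2 * k).+1, exists s : seq W,
      is_path_between (v (inZp (i + k))) (v (inZp (i + k + 1))) s /\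
      (forall w, w \in s -> ~~ H (v i) w)].

Definition has_asteroid : Prop :=
  exists (k : nat) (v : 'I_(2 * k).+1 -> W), asteroid v.

End AnyGraph.

Section Bigraphs.
Variable G : bigraph.
Implicit Types u v : G.

Definition same_part u v : bool :=
  (u \in partX G) && (v \in partX G) || (u \in partY G) && (v \in partY G).

(* The edge joining x in X and y in Y is the pair (x, y), so that every edge
   is represented exactly once. *)
Definition edge : finType :=
  {p : G * G | [&& p.1 \in partX G, p.2 \in partY G & adj p.1 p.2]}.

Definition xend (e : edge) : G := (val e).1.
Definition yend (e : edge) : G := (val e).2.

(* For edges aa' and bb' with a, b in the same part (so a', b' are in the
   other one). Since [adj] is symmetric it does not matter whether a and b
   both lie in X or both lie in Y. *)
Definition independent (a a' b b' : G) : bool :=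
  [&& [disjoint [:: a; a'] & [:: b; b']], ~~ adj a b' & ~~ adj b a'].

Definition I_graph : rel edge :=
  fun e f => independent (xend e) (yend e) (xend f) (yend f).

(* A mixed graph on the vertices of G: undirected edges and arcs. *)
Record mixed_graph := MixedGraph { undirected : rel G; arc : rel G }.

Definition complement_orientation (M : mixed_graph) : Prop :=
  (forall u v, undirected M u v = ~~ same_part u v && ~~ adj u v) /\
  (forall u v, arc M u v -> (u != v) && same_part u v) /\
  (forall u v, u != v -> same_part u v -> arc M u v (+) arc M v u).

Definition T_free (M : mixed_graph) : Prop :=
  ~ exists x x' y y' : G,
      [/\ [/\ x \in partX G, x' \in partX G, y \in partY G & y' \in partY G],
          ~~ adj x y, ~~ adj x' y',
          adj x y' /\ adj x' y &
          arc M x x' /\ arc M y y'].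

Definition has_T_free_orientation : Prop :=
  exists M : mixed_graph, complement_orientation M /\ T_free M.

(* The walks are a :: p and b :: q. *)
Definition congruent (a : G) (p : seq G) (b : G) (q : seq G) : Prop :=
  [/\ is_walk (@adj G) (a :: p) /\ is_walk (@adj G) (b :: q),
      same_part a b,
      size p = size q &
      forall i, i < size p ->
        independent (nth a (a :: p) i) (nth a (a :: p) i.+1)
                    (nth b (b :: q) i) (nth b (b :: q) i.+1)].

(* Distinctness only excludes the vacuous case of one-vertex walks with
   u = v. *)
Definition invertible_pair u v : Prop :=
  u != v /\
  exists p q : seq G, [/\ congruent u p v q, last u p = v & last v q = u].

Definition has_invertible_pair : Prop := exists u v, invertible_pair u v.

(* An end vertex of [e i] is adjacent to its other end vertex, so the walk
   also avoids [e i] itself. *)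
Definition weak_edge_asteroid (k : nat) (e : 'I_(2 * k).+1 -> edge) : Prop :=
  0 < k /\
  forall i : 'I_(2 * k).+1, exists s : seq G,
    [/\ is_walk (@adj G) s,
        (xend (e (inZp (i + k))) \in s) && (yend (e (inZp (i + k))) \in s),
        (xend (e (inZp (i + k + 1))) \in s) &&
        (yend (e (inZp (i + k + 1))) \in s) &
        forall w, w \in s -> ~~ adj w (xend (e i)) && ~~ adj w (yend (e i))].

Definition edge_asteroid (k : nat) (e : 'I_(2 * k).+1 -> edge) : Prop :=
  weak_edge_asteroid e /\ injective e.

Definition has_weak_edge_asteroid : Prop :=
  exists (k : nat) (e : 'I_(2 * k).+1 -> edge), weak_edge_asteroid e.

Definition has_edge_asteroid : Prop :=
  exists (k : nat) (e : 'I_(2 * k).+1 -> edge), edge_asteroid e.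

End Bigraphs.

(* Main.v *)
Require Import Defs.
From mathcomp Require Import all_boot.
From mathcomp Require Import ssralg ssrnum ssrint intdiv zmodp zify.
Set Implicit Arguments.
Unset Strict Implicit.
Unset Printing Implicit Defensive.
Import GRing.Theory.

(* The conditions on the graph G are read off the pair graph, in which (a, b)
   and (a', b') are adjacent when aa' and bb' are independent edges: its
   nontrivial components are the forcing classes of the arcs of I(G), a T-free
   orientation selects one component out of each pair of opposite ones, and an
   invertible pair is a component equal to its own opposite. Going around a weak
   edge-asteroid connects a pair with its opposite.

   For an arbitrary graph I it remains to see that I is a comparability graph
   when its complement H has no asteroid. If no arc is forced to its reverse,
   orient every class so that its lexicographically least arc belongs to the
   orientation; a cyclic triangle could be moved along the classes of its arcs
   until it shows an arc together with its reverse. If an arc is forced to its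
   reverse, the forcing chain is an odd closed walk w in which w(i-1) and w(i+1)
   are connected in H - N[w(i)]. Let the nodes of such a walk be the pairs of
   w(i) and its component of H - N[w(i)], two nodes being adjacent when each
   component contains the vertex of the other: a shortest odd closed walk is an
   induced cycle, from which it follows that its vertices are distinct, and they
   form an asteroid. *)

Lemma connect_map (V W : finType) (r : rel V) (r' : rel W) (f : V -> W) :
  (forall x y, r x y -> r' (f x) (f y)) ->
  forall x y, connect r x y -> connect r' (f x) (f y).
Proof.
move=> hf x y /connectP[p + ->]; elim: p x => //= z p IHp x /andP[rxz /IHp].
by apply: connect_trans; apply/connect1/hf.
Qed.

(** * Forcing classes of arcs and the lexicographic orientation *)

Section Forcing.
Variables (T : finType) (I : rel T).
Hypothesis I_sym : symmetric I.

(** Gallai's forcing: two arcs with a common tail, or a common head, and nonadjacent other ends lie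
    in the same transitive orientations. *)
Definition forces : rel (T * T) := fun p q =>
  [&& I p.1 p.2, I q.1 q.2 &
    (p.1 == q.1) && ~~ I p.2 q.2 || (p.2 == q.2) && ~~ I p.1 q.1].

Lemma forces_sym : symmetric forces.
Proof.
move=> p q; rewrite /forces andbCA [p.1 == _]eq_sym [p.2 == _]eq_sym.
by rewrite [I p.2 q.2]I_sym [I p.1 q.1]I_sym.
Qed.

Lemma forced_sym : connect_sym forces.
Proof. exact/sym_connect_sym/forces_sym. Qed.

Lemma forced_swap a b c d :
  connect forces (a, b) (c, d) -> connect forces (b, a) (d, c).
Proof.
apply: (connect_map (f := fun p => (p.2, p.1))) => -[x y] [z t] /=.
by rewrite /forces /= [I y x]I_sym [I t z]I_sym orbC.
Qed.

Section Orientation.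
Hypothesis no_flip : forall a b, I a b -> ~~ connect forces (a, b) (b, a).

Definition code (p : T * T) : nat := enum_rank p.1 * #|T| + enum_rank p.2.

Lemma code_fst p q : code p <= code q -> enum_rank p.1 <= enum_rank q.1.
Proof.
have divE r : code r %/ #|T| = enum_rank r.1.
  have T_gt0 := leq_ltn_trans (leq0n _) (ltn_ord (enum_rank r.1)).
  by rewrite /code divnMDl // divn_small ?addn0.
by move=> le_pq; rewrite -!divE leq_div2r.
Qed.

Lemma code_inj : injective code.
Proof.
move=> [a b] [c d] eq_code.
have := @code_fst (a, b) (c, d); have := @code_fst (c, d) (a, b).
rewrite eq_code leqnn => /(_ isT) /= le_ca /(_ isT) /= le_ac.
have eq_ac : a = c by apply/enum_rank_inj/val_inj/eqP; rewrite eqn_leq le_ac.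
move: eq_code; rewrite eq_ac /code /= => /addnI eq_bd.
by congr (_, _); apply/enum_rank_inj/val_inj.
Qed.

Definition least_forced p : T * T :=
  [arg min_(q < p | connect forces p q) code q].

Lemma least_forcedP p :
  connect forces p (least_forced p) /\
  forall q, connect forces p q -> code (least_forced p) <= code q.
Proof. by rewrite /least_forced; case: arg_minnP => // q. Qed.

Lemma least_forced_eq p q :
  connect forces p q -> least_forced p = least_forced q.
Proof.
move=> pq; have [[cp lp] [cq lq]] := (least_forcedP p, least_forcedP q).
apply/code_inj/eqP; rewrite eqn_leq lp ?lq //.
  by apply: connect_trans cp; rewrite forced_sym.
exact: connect_trans cq.
Qed.

Definition lex_arc : rel T := fun a b =>
  I a b && (code (least_forced (a, b)) < code (least_forced (b, a))).

Lemma lex_arc_forced a b c d :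
  I c d -> connect forces (a, b) (c, d) -> lex_arc a b -> lex_arc c d.
Proof.
move=> Icd abcd /andP[_]; rewrite /lex_arc Icd (least_forced_eq abcd).
by rewrite (least_forced_eq (forced_swap abcd)).
Qed.

Lemma lex_arc_force a b c d :
  forces (a, b) (c, d) -> lex_arc a b -> lex_arc c d.
Proof.
move=> f; apply: lex_arc_forced (connect1 f).
by case/and3P: f.
Qed.

Lemma lex_arc_asym a b : lex_arc a b -> lex_arc b a = false.
Proof. by rewrite /lex_arc => /andP[_ lt_ab]; rewrite ltnNge ltnW ?andbF. Qed.

(** Equal least codes would put an arc and its reverse in one class. *)
Lemma lex_arc_total a b : I a b -> lex_arc a b || lex_arc b a.
Proof.
move=> Iab; rewrite /lex_arc [I b a]I_sym Iab /= -neq_ltn.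
apply: contra (no_flip Iab) => /eqP/code_inj eq_least.
apply: connect_trans (proj1 (least_forcedP (a, b))) _.
by rewrite eq_least forced_sym; case: (least_forcedP (b, a)).
Qed.

(** If [a] and [c] were nonadjacent, [(a, b)] would force [(c, b)]. *)
Lemma lex_arc_quasi_trans a b c : lex_arc a b -> lex_arc b c -> I a c.
Proof.
move=> ab bc; apply/negPn/negP => nIac.
suff : lex_arc c b by rewrite (lex_arc_asym bc).
apply: (lex_arc_force _ ab); case/andP: ab bc => Iab _ /andP[Ibc _].
by rewrite /forces /= Iab I_sym Ibc eqxx nIac orbT.
Qed.

Definition cyclic3 a b c := [&& lex_arc a b, lex_arc b c & lex_arc c a].

Lemma cyclic3_rot a b c : cyclic3 a b c -> cyclic3 b c a.
Proof. by rewrite /cyclic3 => /and3P[-> -> ->]. Qed.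

(** A form of Golumbic's triangle lemma. At each forcing step [lex_arc_quasi_trans] joins [a] to the
    new end of the facing arc, and the side that changes is itself forced along, so the triangle
    stays cyclic. *)
Lemma cyclic3_move a b c b' c' :
  cyclic3 a b c -> connect forces (b, c) (b', c') ->
  [/\ cyclic3 a b' c', connect forces (a, b) (a, b') &
      connect forces (c, a) (c', a)].
Proof.
move=> + /connectP[p]; elim: p b c => [|[d e] p IHp] b c /= abc.
  by move=> _ [-> ->].
case/andP=> f /IHp{}IHp /IHp{}IHp; have /and3P[ab bc ca] := abc.
have de := lex_arc_force f bc.
have /and3P[/= Ibc Ide /orP[|]] := f => /andP[/eqP eq_ nI].
  rewrite -{}eq_ in f de IHp *; have Iae := lex_arc_quasi_trans ab de.
  have fca : forces (c, a) (e, a).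
    by case/andP: ca => Ica _; rewrite /forces /= Ica I_sym Iae eqxx nI orbT.
  have [|abc' -> h] := IHp; first by rewrite /cyclic3 ab de (lex_arc_force fca).
  by split=> //; apply: connect_trans h; apply: connect1.
rewrite -{}eq_ in f de IHp *; have Ida := lex_arc_quasi_trans de ca.
have fab : forces (a, b) (a, d).
  by case/andP: ab => Iab _; rewrite /forces /= Iab I_sym Ida eqxx nI.
have [|abc' h ->] := IHp; first by rewrite /cyclic3 ca de (lex_arc_force fab).
by split=> //; apply: connect_trans h; apply: connect1.
Qed.

(** Applied to the three rotations, the inequality contradicts itself. If it failed, moving [(a, b)]
    to its least arc [(i, x)] and then [(c, i)] to an arc starting at [i] would give both [i -> x]
    and [x -> i]. *)
Lemma cyclic3_least a b c :
  cyclic3 a b c ->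
  enum_rank (least_forced (c, a)).1 < enum_rank (least_forced (a, b)).1.
Proof.
move=> abc; rewrite ltnNge; apply/negP => le_rank.
case def_ix: (least_forced (a, b)) le_rank => [i x] /= le_rank.
have abix : connect forces (a, b) (i, x).
  by rewrite -def_ix; case: (least_forcedP (a, b)).
have [cix _ bcxc] := cyclic3_move (cyclic3_rot (cyclic3_rot abc)) abix.
have caci : connect forces (c, a) (c, i).
  by case: (cyclic3_move (cyclic3_rot (cyclic3_rot abc)) abix).
have /and3P[ci ix xc] := cix.
have [cky _] := least_forcedP (c, a).
(* The arc [(c, i)] beats [(i, c)], so the least arc of its class starts no later than [i]. *)
have ki : (least_forced (c, a)).1 = i.
  apply/enum_rank_inj/val_inj/eqP; rewrite eqn_leq le_rank andbT.
  apply: (code_fst (q := (i, c))).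
  rewrite (least_forced_eq caci); case/andP: ci => _ /ltnW/leq_trans-> //.
  by case: (least_forcedP (i, c)) => _; apply.
case: (least_forced (c, a)) ki cky => k y /= -> caiy.
have [|/and3P[xi _ _] _ _] := cyclic3_move (b' := i) (c' := y)
  (cyclic3_rot (cyclic3_rot cix)).
  by apply: connect_trans caiy; rewrite forced_sym.
by rewrite (lex_arc_asym ix) in xi.
Qed.

Lemma lex_arc_trans : transitive lex_arc.
Proof.
move=> b a c ab bc; have /lex_arc_total/orP[//|ca] := lex_arc_quasi_trans ab bc.
have abc : cyclic3 a b c by rewrite /cyclic3 ab bc ca.
have bca := cyclic3_rot abc; have cab := cyclic3_rot bca.
have := ltn_trans (cyclic3_least abc)
  (ltn_trans (cyclic3_least bca) (cyclic3_least cab)).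
by rewrite ltnn.
Qed.

Lemma comparability_of_no_flip : comparability_graph I.
Proof.
exists lex_arc; split; last exact: lex_arc_trans.
split=> u v; last by apply/negP => /andP[/lex_arc_asym->].
apply/idP/orP => [/lex_arc_total/orP//|[]/andP[]//].
by rewrite I_sym.
Qed.

End Orientation.
End Forcing.

(** * Components of the complement minus a closed neighbourhood *)

Section Asteroids.
Variables (T : finType) (I : rel T).
Hypotheses (I_sym : symmetric I) (I_irr : irreflexive I).

(** With [H] the complement of [I], the vertices outside [N[v]] in [H] are the [I]-neighbours of
    [v], so [x] and [y] lie in one component of [H - N[v]]. *)
Definition linked v x y :=
  [&& I v x, I v y &
    connect [rel a b | [&& I v a, I v b & ~~ I a b]] x y].

Lemma linked_adj v x y : linked v x y -> I v x /\ I v y.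
Proof. by case/and3P. Qed.

Lemma linked_step v x y : I v x -> I v y -> ~~ I x y -> linked v x y.
Proof.
by move=> vx vy nxy; rewrite /linked vx vy; apply: connect1; rewrite /= vx vy.
Qed.

Lemma linked_refl v x : I v x -> linked v x x.
Proof. by rewrite /linked => ->; rewrite connect0. Qed.

Lemma linked_sym v x y : linked v x y = linked v y x.
Proof.
rewrite /linked andbCA; do 2 congr (_ && _); apply: sym_connect_sym => a b /=.
by rewrite andbCA [I a b]I_sym.
Qed.

Lemma linked_trans v y x z : linked v x y -> linked v y z -> linked v x z.
Proof.
by case/and3P=> vx _ xy /and3P[_ vz yz]; rewrite /linked vx vz;
  apply: connect_trans xy yz.
Qed.

Lemma linked_ind (P : T -> Prop) v x :
  P x ->
  (forall y z, linked v x y -> I v z -> ~~ I y z -> P y -> P z) ->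
  forall y, linked v x y -> P y.
Proof.
move=> Px Pstep y /and3P[vx _ /connectP[p]].
elim: p {1 3 4 5}x Px (linked_refl vx) => [|b p IHp] a Pa xa /=.
  by move=> _ ->.
case/andP=> /and3P[va vb nab]; apply: IHp; first exact: Pstep nab Pa.
by apply: linked_trans xa _; apply: linked_step.
Qed.

Lemma linked_far v x y z : linked v x y -> I v z -> ~~ linked v x z -> I y z.
Proof.
move=> xy vz; apply: contraNT => nyz; apply: (linked_trans xy).
by apply: linked_step => //; case/and3P: (xy).
Qed.

(** No vertex in the component of [x] is near [z], which lies in another component, so the
    connecting path survives the removal of [N[z]]. *)
Lemma linked_transfer v x y z :
  linked v x y -> I v z -> ~~ linked v x z -> linked z x y.
Proof.
move=> xy vz nxz; have far t : linked v x t -> I z t.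
  by move=> xt; rewrite I_sym (linked_far xt).
have xx : linked v x x by case/linked_adj: xy => /linked_refl.
move: y xy; apply: linked_ind => [|y t xy vt nyt]; first exact/linked_refl/far.
have xt : linked v x t.
  by apply: (linked_trans xy); apply: linked_step => //; case/linked_adj: xy.
by move=> /linked_trans; apply; apply: linked_step => //; apply: far.
Qed.

(** * Closed odd walks *)

Section IntIndices.
Local Open Scope ring_scope.

(** Periodic indexing by all integers makes rotation and reversal plain substitutions. *)
Definition closed_odd_walk (n : nat) (w : int -> T) : Prop :=
  [/\ odd n, forall i, w (i + n%:Z) = w i &
      forall i, linked (w i) (w (i - 1)) (w (i + 1))].

Lemma closed_walk_adj n w i : closed_odd_walk n w -> I (w i) (w (i + 1)).
Proof. by case=> _ _ /(_ i)/linked_adj[]. Qed.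

Lemma closed_walk_modE n w i j :
  closed_odd_walk n w -> (n %| j - i)%Z -> w i = w j.
Proof.
case=> _ wn _; have wnk (k : nat) l : w (l + (k * n)%:Z) = w l.
  elim: k l => [|k IHk] l; first by rewrite mul0n addr0.
  by rewrite mulSn addnC PoszD addrA wn IHk.
case/dvdzP=> -[k|k] eq_ji.
  by rewrite -(wnk k i); congr w; rewrite PoszM; lia.
by rewrite -(wnk k.+1 j); congr w; rewrite PoszM; lia.
Qed.

Lemma closed_walk_shift n w (s : int) :
  closed_odd_walk n w -> closed_odd_walk n (fun i => w (i + s)).
Proof.
case=> n_odd wn wl; split=> // i; first by rewrite addrAC wn.
by rewrite addrAC [i + 1 + s]addrAC.
Qed.

Lemma closed_walk_rev n w :
  closed_odd_walk n w -> closed_odd_walk n (fun i => w (- i)).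
Proof.
move=> ww; case: (ww) => n_odd wn wl; split=> // i.
  by apply: (closed_walk_modE ww); apply/dvdzP; exists 1; lia.
by rewrite linked_sym opprD opprB [1 - i]addrC wl.
Qed.

Lemma closed_walk_of_cycle (m : nat) (f : nat -> T) :
  (0 < m)%N -> ~~ odd m ->
  (forall i, (i.+1 < m)%N -> linked (f i.+1) (f i) (f i.+2)) ->
  linked (f m) (f m.-1) (f 0%N) -> linked (f 0%N) (f m) (f 1%N) ->
  closed_odd_walk m.+1 (fun i : int => f `|(i %% m.+1)%Z|%N).
Proof.
move=> m_gt0 m_even fl flm fl0.
have modE (q : int) (j : nat) : (j < m.+1)%N ->
    `|((q * m.+1%:Z + j%:Z)%R %% m.+1)%Z|%N = j.
  by move=> lt_j; rewrite modzMDl modz_small //; lia.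
split=> [|i|i]; first by rewrite /= m_even.
  by rewrite modzDr.
have := divz_eq i m.+1; set q := (i %/ _)%Z.
have: (0 <= (i %% m.+1)%Z < m.+1%:Z)%R by rewrite modz_ge0 // ltz_pmod.
case: (i %% _)%Z => // r /andP[_]; rewrite ltz_nat => lt_r ->.
rewrite absz_nat; case: r lt_r => [|r] lt_r.
  have -> : q * m.+1%:Z + 0 - 1 = (q - 1) * m.+1%:Z + m%:Z by lia.
  have -> : q * m.+1%:Z + 0 + 1 = q * m.+1%:Z + 1%N%:Z by lia.
  by rewrite !modE.
have -> : q * m.+1%:Z + r.+1 - 1 = q * m.+1%:Z + r%:Z by lia.
rewrite modE; last exact: ltnW.
have [eq_r|ne_r] := eqVneq r.+1 m.
  have -> : q * m.+1%:Z + r.+1 + 1 = (q + 1) * m.+1%:Z + 0%N%:Z by lia.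
  by rewrite modE //; move: flm; rewrite -eq_r.
have -> : q * m.+1%:Z + r.+1 + 1 = q * m.+1%:Z + r.+2%:Z by lia.
by rewrite modE ?fl //; lia.
Qed.

(** * Shortest closed odd walks *)

Section Shortest.
Variable n : nat.
Hypothesis n_min : forall m w, (m < n)%N -> ~ closed_odd_walk m w.

(** Adjacency of the nodes [i] and [j]: the component at [w i] is that of [w (i + 1)], which on a
    closed walk is also that of [w (i - 1)]. *)
Definition chord (w : int -> T) i j :=
  linked (w i) (w j) (w (i + 1)) && linked (w j) (w i) (w (j + 1)).

(** The chord would close [w 0, ..., w t] into an odd walk of length [t + 1 < n]. *)
Lemma no_even_chord (w : int -> T) (t : nat) :
  closed_odd_walk n w -> (0 < t)%N -> ~~ odd t -> (t.+1 < n)%N ->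
  ~~ chord w 0 t.
Proof.
move=> ww t_gt0 t_even lt_tn; apply/negP => /andP[l0 lt].
case: (ww) => _ _ wl; apply: (n_min lt_tn).
apply: (closed_walk_of_cycle (f := fun i : nat => w i%:Z)) => // [i _|].
- have := wl i.+1; have -> : i.+1%:Z - 1 = i by lia.
  by have -> : i.+1%:Z + 1 = i.+2 by lia.
- have := wl t; rewrite linked_sym => /(linked_trans lt).
  by rewrite linked_sym; have -> : t%:Z - 1 = t.-1 by lia.
Qed.

Lemma chord_shift w s i j :
  chord (fun k => w (k + s)) i j = chord w (i + s) (j + s).
Proof. by rewrite /chord (addrAC i 1) (addrAC j 1). Qed.

Lemma chord_sym w i j : chord w i j = chord w j i.
Proof. by rewrite /chord andbC. Qed.

Lemma chord_mod w i j i' j' :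
  closed_odd_walk n w -> (n %| i' - i)%Z -> (n %| j' - j)%Z ->
  chord w i j -> chord w i' j'.
Proof.
move=> ww ni nj; have succ_mod a b : (n %| b - a)%Z -> w (b + 1) = w (a + 1).
  move=> nab; apply/esym/(closed_walk_modE ww).
  by rewrite opprD addrACA subrr addr0.
by rewrite /chord (succ_mod _ _ ni) (succ_mod _ _ nj)
  (closed_walk_modE ww ni) (closed_walk_modE ww nj).
Qed.

(** Of the two ways round between [i] and [j] one has even length, and a chord would close it into a
    shorter odd walk. *)
Lemma chord_consecutive w i j :
  closed_odd_walk n w -> chord w i j ->
  (n %| j - i - 1)%Z \/ (n %| j - i + 1)%Z.
Proof.
move=> ww cij; have [n_odd _ _] := ww.
have n_gt0 : (0 < n)%N by case: (n) n_odd.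
pose r := `|((j - i)%R %% n)%Z|%N.
have [lt_rn /dvdzP[q def_r]] : (r < n)%N /\ (n %| j - i - r%:Z)%Z.
  have ge0 : (0 <= ((j - i)%R %% n)%Z)%R by rewrite modz_ge0 // lt0n_neq0.
  have def_r : r = ((j - i)%R %% n)%Z :> int by rewrite /r; lia.
  split; first by rewrite -ltz_nat def_r ltz_pmod.
  apply/dvdzP; exists ((j - i)%R %/ n)%Z.
  by rewrite def_r {1}(divz_eq (j - i) n) addrK.
have no_chord := no_even_chord (closed_walk_shift _ ww).
case: (ltnP 1 r) => [r_gt1|le_r1]; last first.
  have [r0|r_neq0] := eqVneq r 0%N; last by left; apply/dvdzP; exists q; lia.
  case/andP: cij => /linked_adj[].
  rewrite (closed_walk_modE (j := j) ww) ?I_irr //.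
  by apply/dvdzP; exists q; lia.
have [eq_rn|ne_rn] := eqVneq r.+1 n.
  by right; apply/dvdzP; exists (q + 1); lia.
case: (boolP (odd r)) => [r_odd|r_even]; exfalso.
  have /negP[] : ~~ chord (fun k => w (k + j)) 0 (n - r)%N.
    by apply: no_chord; lia.
  rewrite chord_shift chord_sym; apply: chord_mod cij => //; apply/dvdzP.
    by exists (q + 1); lia.
  by exists 0; lia.
have /negP[] : ~~ chord (fun k => w (k + i)) 0 r by apply: no_chord; lia.
rewrite chord_shift; apply: chord_mod cij => //; apply/dvdzP.
  by exists 0; lia.
by exists (- q); lia.
Qed.

(** [n] is odd, and [n = 1] would make a vertex [I]-adjacent to itself. *)
Lemma closed_walk_ndvd w (k : nat) :
  closed_odd_walk n w -> k \in [:: 1; 2; 4]%N -> ~ (n %| k)%N.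
Proof.
move=> ww; have [n_odd wn _] := ww.
have n_gt2 : (2 < n)%N.
  case: (n) n_odd wn => [|[|[|//]]] // _ wn.
  by have := closed_walk_adj 0 ww; rewrite wn I_irr.
rewrite !inE => k_le nk; have k_gt0 : (0 < k)%N by lia.
have := dvdn_leq k_gt0 nk; case/or3P: k_le nk n_odd n_gt2 => /eqP->;
  by case: (n) => [|[|[|[|[|]]]]].
Qed.

(* Otherwise the component of [w (s + 1)] in the complement minus [N[w s]] is
   disjoint from the component of [w s] in the complement minus
   [N[w (s + 1)]], which contains [w (s + 2)]; this makes [s - 1] and [s + 2]
   a chord. *)
Lemma escape_succ w s :
  closed_odd_walk n w ->
  exists c z, [/\ linked (w s) (w (s + 1)) c, ~~ I (w s) z,
                  I (w (s + 1)) z & ~~ I c z].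
Proof.
move=> ww; have [_ _ wl] := ww; set v := w s; set u := w (s + 1).
case: (boolP [exists c, exists z,
  [&& linked v u c, ~~ I v z, I u z & ~~ I c z]]) => [|none].
  by case/existsP=> c /existsP[z /and4P[]]; exists c, z.
have vu := closed_walk_adj s ww; rewrite -/v -/u in vu.
(* If the next vertex [z] of the path met [c] in [H], it would lie either in the component of [c],
   against the induction hypothesis, or in [N[v]], as the excluded witness. *)
have apart y : linked u v y -> forall c, linked v u c -> I y c.
  move: y; apply: linked_ind => [c /linked_adj[] //|y z uy uz nyz Iy c vc].
  apply/negPn/negP => nzc; case: (boolP (I v z)) => [vz|nvz].
    case/negP: nyz; apply: Iy; apply: (linked_trans vc).
    by apply: linked_step => //; [case/linked_adj: vc | rewrite I_sym].
  case/negP: none; apply/existsP; exists c; apply/existsP; exists z.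
  by rewrite vc nvz uz I_sym.
have ux : linked u v (w (s + 2%:Z)).
  by have := wl (s + 1); rewrite addrK -addrA.
have va : linked v u (w (s - 1)) by rewrite linked_sym wl.
have uv : I u v by rewrite I_sym.
have au y : linked u v y -> linked (w (s - 1)) v y.
  suff: linked u v y -> linked u v y /\ linked (w (s - 1)) v y by move=> h /h[].
  move: y; apply: linked_ind => [|y z uy uz nyz [_ ay]].
    by split; apply: linked_refl; rewrite // I_sym apart // linked_refl.
  have uvz : linked u v z.
    by apply: (linked_trans uy); apply: linked_step => //; case/linked_adj: uy.
  split=> //; apply: (linked_trans ay); apply: linked_step => //.
    by rewrite I_sym apart.
  by rewrite I_sym apart.
have xu y : linked v u y -> linked (w (s + 2%:Z)) u y.
  suff: linked v u y -> linked v u y /\ linked (w (s + 2%:Z)) u y.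
    by move=> h /h[].
  move: y; apply: linked_ind => [|y z vy vz nyz [_ xy]].
    by split; apply: linked_refl; rewrite // apart // linked_refl.
  have vuz : linked v u z.
    by apply: (linked_trans vy); apply: linked_step => //; case/linked_adj: vy.
  split=> //; apply: (linked_trans xy).
  by apply: linked_step => //; apply: apart.
have /(chord_consecutive ww) : chord w (s + 2%:Z) (s - 1).
  apply/andP; split.
    have ax := xu _ va; rewrite linked_sym in ax; apply: (linked_trans ax).
    have := wl (s + 2%:Z); have -> : s + 2%:Z - 1 = s + 1 by lia.
    done.
  by rewrite subrK linked_sym; apply: au.
(* Indices three apart are consecutive modulo [n] only if [n] divides 2 or 4. *)
have [-> ->] : s - 1 - (s + 2%:Z) - 1 = - 4%:Z /\
  s - 1 - (s + 2%:Z) + 1 = - 2%:Z by lia.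
have ndvd k := @closed_walk_ndvd w k ww.
by case=> [/(ndvd 4%N isT)|/(ndvd 2%N isT)].
Qed.

Lemma escape_pred w s :
  closed_odd_walk n w ->
  exists c z, [/\ linked (w s) (w (s - 1)) c, ~~ I (w s) z,
                  I (w (s - 1)) z & ~~ I c z].
Proof.
move=> /closed_walk_rev/escape_succ-/(_ (- s)).
by rewrite opprD !opprK.
Qed.

(** Otherwise [p] and [q] are the same node, so [p] is adjacent to both [q - 1] and [q + 1]; as
    chords join consecutive indices only, [n] divides [q - p] or 4. *)
Lemma repeat_unlinked w p q :
  closed_odd_walk n w -> w p = w q -> ~ (n %| q - p)%Z ->
  ~~ linked (w p) (w (p + 1)) (w (q + 1)).
Proof.
move=> ww eq_pq npq; have [_ _ wl] := ww.
apply/negP => pq1.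
have c1 : chord w p (q + 1).
  rewrite /chord linked_sym pq1 eq_pq /=.
  by have := wl (q + 1); rewrite addrK.
have c2 : chord w p (q - 1).
  rewrite /chord subrK eq_pq linked_refl ?andbT.
    by apply: linked_trans (wl q) _; rewrite linked_sym -eq_pq.
  by have := closed_walk_adj (q - 1) ww; rewrite subrK.
have [/dvdzP[a d1]|/dvdzP[a d1]] := chord_consecutive ww c1.
  by apply: npq; apply/dvdzP; exists a; lia.
have [/dvdzP[b d2]|/dvdzP[b d2]] := chord_consecutive ww c2; last first.
  by apply: npq; apply/dvdzP; exists b; lia.
apply: (@closed_walk_ndvd _ 4 ww) => //.
have : (n %| 4%:Z)%Z by apply/dvdzP; exists (a - b); lia.
by [].
Qed.

(** Both links together make [p + 1] and [q + 1] a chord, hence consecutive, and then two successive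
    vertices of the walk coincide. *)
Lemma repeat_dichotomy w p q :
  closed_odd_walk n w -> w p = w q ->
  ~~ (linked (w (p + 1)) (w p) (w (q + 1)) &&
      linked (w (q + 1)) (w p) (w (p + 1))).
Proof.
move=> ww eq_pq; have [_ _ wl] := ww; apply/negP => /andP[l1 l2].
have : chord w (p + 1) (q + 1).
  apply/andP; split.
    rewrite linked_sym in l1; apply: (linked_trans l1).
    by have := wl (p + 1); rewrite addrK.
  rewrite linked_sym in l2; apply: (linked_trans l2); rewrite eq_pq.
  by have := wl (q + 1); rewrite addrK.
case/(chord_consecutive ww) => /dvdzP[a da].
  have := closed_walk_adj p ww.
  rewrite eq_pq (closed_walk_modE (i := p + 1) (j := q) ww).
    by rewrite I_irr.
  by apply/dvdzP; exists a; lia.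
have := closed_walk_adj q ww.
rewrite -eq_pq (closed_walk_modE (i := q + 1) (j := p) ww).
  by rewrite I_irr.
by apply/dvdzP; exists (- a); lia.
Qed.

(* Replacing [w q] by [w (p + 1)] gives another closed walk in which [p + 1]
   and [q] satisfy the same hypotheses, so [p] moves up until it meets [q]. *)
Lemma repeat_slide (d : nat) w p q :
  closed_odd_walk n w -> w p = w q -> q = p + d%:Z -> (0 < d < n)%N ->
  linked (w (q - 1)) (w p) (w (p + 1)) ->
  linked (w (q + 1)) (w p) (w (p + 1)) -> False.
Proof.
elim: d w p => [|d IHd] w p ww eq_pq def_q; first by rewrite ltnn.
move=> /andP[_ lt_dn] la lb; have [n_odd wn wl] := ww.
(* Distances 1 and 2 make a vertex [I]-adjacent to itself; afterwards the distance is [d.+3]. *)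
case: d IHd def_q lt_dn => [|d] IHd def_q lt_dn.
  by have := closed_walk_adj p ww; rewrite {1}eq_pq def_q I_irr.
case: d IHd def_q lt_dn => [|d] IHd def_q lt_dn.
  by case/linked_adj: la => _; rewrite def_q (_ : _ - 1 = p + 1) ?I_irr //; lia.
have nq k : (0 < k < n)%N -> ~ (n %| k%:Z)%Z.
  by case/andP=> k_gt0 lt_kn /(dvdn_leq k_gt0); rewrite leqNgt lt_kn.
have ndvd k := @closed_walk_ndvd w k ww.
pose b := w (p + 1); pose w' i := if (n %| i - q)%Z then b else w i.
have w'E i : ~ (n %| i - q)%Z -> w' i = w i by rewrite /w' => /negP/negPf->.
have w'q : w' q = b by rewrite /w' subrr dvdz0.
have npq : ~ (n %| q - p)%Z.
  have -> : q - p = d.+3%:Z by lia.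
  by apply: nq; lia.
have unl := repeat_unlinked ww eq_pq npq.
have labq : linked (w p) (w (q - 1)) (w (q + 1)) by rewrite eq_pq.
have vb : I (w p) b := closed_walk_adj p ww.
have lbab : linked b (w (q - 1)) (w (q + 1)).
  apply: (linked_transfer labq vb); apply: contra unl; rewrite linked_sym.
  by move/linked_trans; apply.
(* The condition at [q] is [lbab]; at [q - 1] and [q + 1], [la] and [lb] exchange [w q] for [b]. *)
have ww' : closed_odd_walk n w'.
  split=> // i.
    by rewrite /w' wn addrAC (sameP dvdz_mod0P eqP) modzDr
      -(sameP dvdz_mod0P eqP).
  have wmod j k : (n %| k - j)%Z -> w j = w k := closed_walk_modE ww.
  rewrite {1}/w'; case: ifP => [/dvdzP[a da]|/negP ni].
    rewrite !w'E.
    - rewrite (wmod (i - 1) (q - 1)) 1?(wmod (i + 1) (q + 1)) //;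
        apply/dvdzP; exists (- a); lia.
    - move=> /dvdzP[c dc]; apply: (ndvd 1%N) => //.
      by suff: (n %| 1%N%:Z)%Z by []; apply/dvdzP; exists (c - a); lia.
    - move=> /dvdzP[c dc]; apply: (ndvd 1%N) => //.
      by suff: (n %| 1%N%:Z)%Z by []; apply/dvdzP; exists (a - c); lia.
  rewrite /w'; case: ifP => [/dvdzP[a da]|/negP npred].
    rewrite ifN; last first.
      apply/negP=> /dvdzP[c dc]; apply: (ndvd 2%N) => //.
      by suff: (n %| 2%N%:Z)%Z by []; apply/dvdzP; exists (c - a); lia.
    have iq : w i = w (q + 1) by apply: wmod; apply/dvdzP; exists (- a); lia.
    have i1q : w (i - 1) = w q by apply: wmod; apply/dvdzP; exists (- a); lia.
    have := wl i; rewrite iq i1q; apply: linked_trans.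
    by rewrite linked_sym -eq_pq.
  case: ifP => [/dvdzP[a da]|//].
  have iq : w i = w (q - 1) by apply: wmod; apply/dvdzP; exists (- a); lia.
  have i1q : w (i + 1) = w q by apply: wmod; apply/dvdzP; exists (- a); lia.
  by have := wl i; rewrite iq i1q => /linked_trans; apply; rewrite -eq_pq.
have w'p : w' (p + 1) = b by rewrite /w'; case: ifP.
have w'p2 : w' (p + 1 + 1) = w (p + 1 + 1).
  apply: w'E => /dvdzP[a da]; apply: (nq d.+1); first by lia.
  by apply/dvdzP; exists (- a); lia.
have w'q1 : w' (q - 1) = w (q - 1).
  apply: w'E => /dvdzP[a da]; apply: (ndvd 1%N) => //.
  by suff: (n %| 1%N%:Z)%Z by []; apply/dvdzP; exists (- a); lia.
have w'q2 : w' (q + 1) = w (q + 1).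
  apply: w'E => /dvdzP[a da]; apply: (ndvd 1%N) => //.
  by suff: (n %| 1%N%:Z)%Z by []; apply/dvdzP; exists a; lia.
have np1q : ~ (n %| q - (p + 1))%Z.
  have -> : q - (p + 1) = d.+2%:Z by lia.
  by apply: nq; lia.
have := @repeat_unlinked w' (p + 1) q ww' (etrans w'p (esym w'q)) np1q.
rewrite w'p w'p2 w'q2 => unl'.
have lbv : linked b (w p) (w (p + 1 + 1)) by have := wl (p + 1); rewrite addrK.
(* By [unl'], [u] and [w (p + 2)] lie in different components at [b], so the link [lbv] transfers to
   [u]. With [u] taken as [w (q - 1)] and [w (q + 1)], this gives the induction hypotheses at
   [p + 1]. *)
have far u : linked b (w (q + 1)) u -> linked u (w p) b ->
    linked u b (w (p + 1 + 1)).
  move=> lu luv; rewrite linked_sym in luv; apply: (linked_trans luv).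
  have nlu : ~~ linked b (w (p + 1 + 1)) u.
    by apply: contra unl' => /linked_trans; apply; rewrite linked_sym.
  apply: (linked_transfer lbv); first by case/linked_adj: lu.
  by apply: contra nlu; apply: linked_trans; rewrite linked_sym.
apply: (IHd w' (p + 1)); rewrite ?w'p ?w'q ?w'q1 ?w'q2 ?w'p2 //; try lia.
  by apply: far => //; rewrite linked_sym.
by apply: far => //; apply: linked_refl; case/linked_adj: lbab.
Qed.

(** Let [u] be [w (q - 1)] or [w (q + 1)], and [z] an escape from its component at [w p]. If [z] is
    not near [w (p + 1)], it yields the link; otherwise [w p, z, w (p + 1)] is a path in [H - N[u]],
    and [repeat_slide] applies. *)
Lemma repeat_linked (d : nat) w p q :
  closed_odd_walk n w -> w p = w q -> q = p + d%:Z -> (0 < d < n)%N ->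
  linked (w (p + 1)) (w p) (w (q + 1)).
Proof.
move=> ww eq_pq def_q d_lt; have [_ _ wl] := ww.
apply/negPn/negP => nl.
have npq : ~ (n %| q - p)%Z.
  rewrite def_q addrC addKr; case/andP: d_lt => d_gt0 lt_dn /(dvdn_leq d_gt0).
  by rewrite leqNgt lt_dn.
have unl := repeat_unlinked ww eq_pq npq.
have vb := closed_walk_adj p ww.
have vb' := closed_walk_adj q ww; rewrite -eq_pq in vb'.
have to_b u : linked (w p) u (w (q + 1)) ->
    (exists c z, [/\ linked (w p) u c, ~~ I (w p) z, I u z & ~~ I c z]) ->
    linked u (w p) (w (p + 1)).
  move=> lub [c [z [lc nvz uz ncz]]].
  have bu x : linked (w p) u x -> linked (w (p + 1)) u x.
    move=> lx; apply: (linked_transfer lx vb); apply: contra unl.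
    by rewrite linked_sym => /linked_trans; apply.
  have [vu _] := linked_adj lub.
  have ub : I u (w (p + 1)).
    by rewrite I_sym; case/linked_adj: (bu _ lub).
  case: (boolP (I (w (p + 1)) z)) => [bz|nbz].
    case/negP: nl; apply: linked_trans (_ : linked _ _ z) _.
      by apply: linked_step => //; rewrite I_sym.
    apply: linked_trans (_ : linked _ _ c) _.
      by apply: linked_step => //; [case/linked_adj: (bu _ lc) | rewrite I_sym].
    have lcu := bu _ lc; rewrite linked_sym in lcu.
    exact: linked_trans lcu (bu _ lub).
  apply: linked_trans (_ : linked _ _ z) _.
    by apply: linked_step => //; rewrite I_sym.
  by apply: linked_step => //; rewrite I_sym.
apply: (repeat_slide ww eq_pq def_q d_lt); apply: to_b.
- by rewrite eq_pq.
- by rewrite eq_pq; apply: escape_pred.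
- exact: linked_refl.
- by rewrite eq_pq; apply: escape_succ.
Qed.

(** A repetition at [p] and [q] is also one at [q] and [p + n], so [repeat_linked] gives both links
    that [repeat_dichotomy] excludes. *)
Lemma shortest_inj (d : nat) w p :
  closed_odd_walk n w -> (0 < d < n)%N -> w p <> w (p + d%:Z).
Proof.
move=> ww d_lt eq_pq; set q := p + d%:Z in eq_pq.
have := repeat_dichotomy ww eq_pq; rewrite (repeat_linked ww eq_pq _ d_lt) //=.
have [_ wn _] := ww.
have def_pn : p + n%:Z = q + (n - d)%N%:Z by rewrite /q; lia.
have := @repeat_linked (n - d)%N w q (p + n%:Z) ww.
rewrite wn (addrAC p n 1) wn eq_pq => -> //; lia.
Qed.

Lemma asteroid_of_shortest w :
  closed_odd_walk n w -> has_asteroid (complement I).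
Proof.
move=> ww; have [n_odd _ wl] := ww; have nE := odd_double_half n.
rewrite n_odd add1n -mul2n in nE; set k := n./2 in nE.
have n_neq1 : n <> 1%N.
  by move=> n1; apply: (@closed_walk_ndvd w 1 ww); rewrite // n1.
(* Modulo [n = 2k + 1], doubling sends [i + k] and [i + k + 1] to [2i - 1] and [2i + 1], the indices
   linked at [2i]. *)
exists k, (fun i : 'I_(2 * k).+1 => w (2 * i%:Z)); split; first by lia.
  move=> i j eq_w; apply/val_inj/eqP; move: i j eq_w.
  suff lt_neq (a b : nat) : (a < b <= 2 * k)%N -> w (2 * a%:Z) <> w (2 * b%:Z).
    move=> [i /= lt_i] [j /= lt_j] eq_w; case: ltngtP => // [lt_ij|lt_ji].
      by case: (@lt_neq i j) => //; lia.
    by case: (@lt_neq j i) => //; lia.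
  (* The doubled indices differ by less than [2n], and not by [n], which is odd. *)
  move=> lt_ab; case: (ltnP (2 * (b - a)) n) => [lt_n|le_n] eq_w.
    apply: (@shortest_inj (2 * (b - a))%N w (2 * a%:Z) ww); first by lia.
    by rewrite eq_w; congr w; lia.
  apply: (@shortest_inj (2 * (b - a) - n)%N w (2 * a%:Z) ww); first by lia.
  rewrite eq_w; apply: (closed_walk_modE ww).
  by apply/dvdzP; exists (- 1); lia.
move=> i; have inZpE (m : nat) (j : int) : (n %| j - 2 * m%:Z)%Z ->
    w (2 * (inZp m : 'I_(2 * k).+1)%:Z) = w j.
  move=> nj; apply: (closed_walk_modE ww); case/dvdzP: nj => a da.
  have := divn_eq m (2 * k).+1; rewrite /= nE => dm.
  apply/dvdzP; exists (a + 2 * (m %/ n)%:Z).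
  by rewrite [RHS]mulrDl -da -mulrA -PoszM; lia.
rewrite (inZpE _ (2 * i%:Z - 1)); last by apply/dvdzP; exists (- 1); lia.
rewrite (inZpE _ (2 * i%:Z + 1)); last by apply/dvdzP; exists (- 1); lia.
have /and3P[vx vy /connectP[p path_p ->]] := wl (2 * i%:Z).
case/shortenP: path_p => q path_q uniq_q _.
exists (w (2 * i%:Z - 1) :: q); split.
  rewrite /is_path_between /is_walk uniq_q !eqxx !andbT.
  elim: q (w (2 * i%:Z - 1)) path_q uniq_q {vx} => //= b q IHq a.
  case/andP=> /and3P[_ _ nab] path_q.
  case/andP; rewrite inE negb_or => /andP[ne_ab _] uniq_q.
  by rewrite {1}/complement ne_ab nab IHq.
move=> x; rewrite inE => /predU1P[->|]; first by rewrite /complement vx andbF.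
elim: q (w (2 * i%:Z - 1)) path_q {uniq_q vx} => //= b q IHq a.
case/andP=> /and3P[_ vb _] /IHq{}IHq; rewrite inE => /predU1P[->|//].
by rewrite /complement vb andbF.
Qed.

End Shortest.
Lemma no_closed_walk n w :
  ~ has_asteroid (complement I) -> ~ closed_odd_walk n w.
Proof.
move=> no_asteroid; have [m le_nm] := ubnP n.
elim: m => // m IHm in n w le_nm * => ww; apply: no_asteroid.
apply: (asteroid_of_shortest _ ww) => n' w' lt_n'; apply: IHm.
exact: leq_trans lt_n' _.
Qed.

End IntIndices.
(** A forcing step from [(c, d)] to [(c', d')] appends [d', c'] after [d, c]: the shared end makes
    one new link trivial, and nonadjacency of the other ends gives the second. The parity of [m] is
    kept. *)
Lemma walk_of_forced a b c d :
  I a b -> connect (forces I) (a, b) (c, d) ->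
  exists (m : nat) (f : nat -> T),
    [/\ ~~ odd m, f 0 = b /\ f 1 = a, f m = d /\ f m.+1 = c &
        forall i, i < m -> linked (f i.+1) (f i) (f i.+2)].
Proof.
move=> Iab /connectP[p]; elim/last_ind: p c d => [|p [c' d'] IHp] c d.
  by move=> _ [-> ->]; exists 0, (fun i => if i is 0 then b else a).
rewrite rcons_path last_rcons => /andP[path_p step] [-> ->] {c d}.
case def_cd: (last (a, b) p) step => [c d] step.
have [m [f [m_even f01 [fm fm1] fl]]] := IHp c d path_p (esym def_cd).
pose g i := if i <= m.+1 then f i else if i == m.+2 then d' else c'.
have gE i : i <= m.+1 -> g i = f i by rewrite /g => ->.
have gm2 : g m.+2 = d' by rewrite /g ltnn eqxx.
have gm3 : g m.+3 = c' by rewrite /g ltnNge leqnSn /= gtn_eqF.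
exists m.+2, g; split; rewrite ?gm2 ?gm3 ?gE //=; first by rewrite negbK.
case/and3P: step => /= Icd Icd' h i; rewrite !ltnS leq_eqVlt => /predU1P[->|].
  rewrite gm2 gm3 !gE // fm1.
  case/orP: h => /andP[/eqP eq_ nI]; last first.
    rewrite -eq_ in Icd' *.
    by apply: linked_step; rewrite // I_sym.
  by rewrite eq_; apply: linked_refl; rewrite I_sym.
rewrite ltnS leq_eqVlt => /predU1P[->|lt_i]; last first.
  by rewrite !gE ?fl //; lia.
rewrite gm2 !gE // fm fm1.
case/orP: h => /andP[/eqP eq_ nI]; last first.
  by rewrite -eq_; apply: linked_refl.
by apply: linked_step; rewrite // eq_.
Qed.

Lemma no_flip_of_no_asteroid a b :
  ~ has_asteroid (complement I) -> I a b -> ~~ connect (forces I) (a, b) (b, a).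
Proof.
move=> no_asteroid Iab; apply/negP => /(walk_of_forced Iab).
case=> m [f [m_even [f0 f1] [fm fm1] fl]].
have m_gt0 : 0 < m.
  by case: (m) fm => // f0'; move: Iab; rewrite -f0' f0 I_irr.
apply: (no_closed_walk no_asteroid).
(* As [f m.+1 = b = f 0], the walk closes after [m + 1] vertices, and both neighbours of [f 0] are
   [a]. *)
apply: (closed_walk_of_cycle (f := f) m_gt0 m_even).
- by move=> i lt_i; apply: fl; apply: ltnW.
- by have := fl m.-1; rewrite prednK // fm1 -f0; apply.
- by rewrite f0 f1 fm; apply: linked_refl; rewrite I_sym.
Qed.

End Asteroids.

(** * Bipartite graphs and independence of their edges *)

Section BipartiteGraph.
Variable G : bigraph.
Implicit Types (u v x y : G) (e f : edge G).

Lemma partYE u : (u \in partY G) = (u \notin partX G).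
Proof.
have /setP/(_ u) := part_cover G; rewrite !inE.
case: (boolP (u \in partX G)) => //= uX _.
exact: disjointFr (part_disjoint G) uX.
Qed.

Lemma adj_partX u v : adj u v -> (v \in partX G) = (u \notin partX G).
Proof.
by move/adj_cross; rewrite !partYE; case: (u \in _); case: (v \in _).
Qed.

Lemma same_partE u v : same_part u v = ((u \in partX G) == (v \in partX G)).
Proof. by rewrite /same_part !partYE; case: (u \in _); case: (v \in _). Qed.

Lemma same_part_nadj u v : same_part u v -> ~~ adj u v.
Proof.
by rewrite same_partE; apply: contraTN => /adj_partX->; case: (u \in _).
Qed.

Lemma edgeP e :
  [/\ xend e \in partX G, yend e \notin partX G & adj (xend e) (yend e)].
Proof. by case/and3P: (valP e); rewrite partYE. Qed.

Lemma edge_of_adj u v : adj u v -> u \in partX G ->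
  exists e : edge G, xend e = u /\ yend e = v.
Proof.
move=> uv uX.
have uvP : [&& u \in partX G, v \in partY G & adj u v].
  by rewrite uX partYE (adj_partX uv) uX.
by exists (Sub (u, v) uvP).
Qed.

Lemma independentE u u' v v' : same_part u v -> adj u u' -> adj v v' ->
  independent u u' v v' = ~~ adj u v' && ~~ adj v u'.
Proof.
rewrite same_partE /independent => /eqP uv uu' vv'; apply: andb_idl.
case/andP=> nuv' nvu'; rewrite disjoint_has /= !inE !orbF !negb_or -!andbA.
have u'X := adj_partX uu'; have v'X := adj_partX vv'.
apply/and4P; split; apply/eqP => eq_.
- by rewrite eq_ (negPf nvu') in uu'.
- by rewrite -eq_ -uv in v'X; case: (u \in _) v'X.
- by rewrite eq_ -uv in u'X; case: (u \in _) u'X.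
- by rewrite eq_ (negPf nuv') in uu'.
Qed.

Lemma I_graphE e f :
  I_graph e f = ~~ adj (xend e) (yend f) && ~~ adj (xend f) (yend e).
Proof.
have [xe ye ae] := edgeP e; have [xf yf af] := edgeP f.
by rewrite /I_graph independentE // same_partE xe xf.
Qed.

Lemma I_graph_sym : symmetric (@I_graph G).
Proof. by move=> e f; rewrite !I_graphE andbC. Qed.

Lemma I_graph_irr : irreflexive (@I_graph G).
Proof. by move=> e; rewrite I_graphE; case: (edgeP e) => _ _ ->. Qed.

(** * The pair graph, whose walks are the pairs of congruent walks *)

Definition pair_step : rel (G * G) := fun p q =>
  [&& adj p.1 q.1, adj p.2 q.2, ~~ adj p.1 q.2 & ~~ adj p.2 q.1].

Lemma pair_step_sym : symmetric pair_step.
Proof.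
move=> [a b] [c d]; rewrite /pair_step /= (adj_sym a c) (adj_sym b d).
by rewrite (adj_sym a d) (adj_sym b c) (andbC (~~ adj d a)).
Qed.

Lemma pair_conn_swap u v u' v' :
  connect pair_step (u, v) (u', v') -> connect pair_step (v, u) (v', u').
Proof.
apply: (connect_map (f := fun p => (p.2, p.1))) => -[a b] [c d].
by rewrite /pair_step /= => /and4P[-> -> -> ->].
Qed.

Lemma same_part_step u v u' v' :
  adj u u' -> adj v v' -> same_part u v -> same_part u' v'.
Proof. by rewrite !same_partE => /adj_partX-> /adj_partX-> /eqP->. Qed.

Lemma congruent_of_conn u v u' v' :
  same_part u v -> connect pair_step (u, v) (u', v') ->
  exists p q, [/\ congruent u p v q, last u p = u' & last v q = v'].
Proof.
move=> uv /connectP[s]; elim: s u v uv => [|[a b] s IHs] u v uv /=.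
  by move=> _ [-> ->]; exists [::], [::].
case/andP=> /and4P[/= ua vb nub nva] path_s last_s.
have ab := same_part_step ua vb uv.
have [p [q [[[wp wq] _ sz ind] lp lq]]] := IHs _ _ ab path_s last_s.
exists (a :: p), (b :: q); split=> //; split=> //=; last 2 first.
- by rewrite sz.
- case=> [_|i lt_i] /=; first by rewrite independentE // nub.
  have lt_iq : i < size q by rewrite -sz.
  have := ind i lt_i; rewrite /= (set_nth_default u a)
    ?(set_nth_default u a lt_i); last exact: ltnW.
  by rewrite (set_nth_default v b) ?(set_nth_default v b lt_iq) // ltnW.
by rewrite ua vb.
Qed.

(** * Transitive orientations of [I(G)] and T-free orientations *)

Definition end_arc (A : rel (edge G)) : rel G := fun u v =>
  [exists e, exists f, A e f && ((xend e == u) && (xend f == v) ||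
                                 (yend e == u) && (yend f == v))].

Lemma end_arcP (A : rel (edge G)) u v :
  reflect (exists e f, A e f /\ ((xend e = u /\ xend f = v) \/
                                (yend e = u /\ yend f = v)))
          (end_arc A u v).
Proof.
apply: (iffP existsP) => [[e /existsP[f /andP[ef /orP uv]]]|[e [f [ef uv]]]].
  by exists e, f; split=> //; case: uv => /andP[/eqP-> /eqP->]; [left | right].
exists e; apply/existsP; exists f; rewrite ef /=.
by case: uv => -[-> ->]; rewrite !eqxx ?orbT.
Qed.

(** If [e -> f] and [e' -> f'] induced opposite arcs, [e] and [f'] would share an end, as would [f]
    and [e'], while [e] and [e'] are independent; either orientation of this last pair composes to
    an arc between dependent edges. *)
Lemma end_arc_asym (A : rel (edge G)) u v :
  orientation (@I_graph G) A -> transitive A ->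
  end_arc A u v -> end_arc A v u = false.
Proof.
move=> [orA asymA] trA; apply/contraTF => /end_arcP[e' [f' [ef' vu]]].
apply/end_arcP => -[e [f [ef uv]]].
have IA a b : A a b -> I_graph a b by rewrite orA => ->.
have [Ief Ief'] := (IA _ _ ef, IA _ _ ef').
have [Iee' nIfe' nIef'] : [/\ I_graph e e', ~~ I_graph f e' & ~~ I_graph e f'].
  have [[xe ye ae] [xf yf af]] := (edgeP e, edgeP f).
  have [[xe' ye' ae'] [xf' yf' af']] := (edgeP e', edgeP f').
  move: Ief Ief'; rewrite !I_graphE => /andP[n1 n2] /andP[n3 n4].
  case: uv vu => -[<- <-] [] -[eq3 eq4].
  - by split; [rewrite -eq4 n4 eq3 n2 | rewrite -eq3 ae' | rewrite -eq4 af'].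
  - by rewrite eq4 xe in yf'.
  - by rewrite -eq4 xf' in ye.
  - by split; [rewrite eq3 n1 -eq4 n3 | rewrite eq3 af | rewrite eq4 ae].
move: Iee'; rewrite orA => /orP[ee'|e'e].
  by case/negP: nIef'; apply: IA; apply: trA ee' ef'.
by case/negP: nIfe'; rewrite I_graph_sym; apply: IA; apply: trA e'e ef.
Qed.

Lemma T_free_of_comparability :
  comparability_graph (@I_graph G) -> has_T_free_orientation G.
Proof.
case=> A [orA trA]; have asym u v := end_arc_asym (u := u) (v := v) orA trA.
(* Pairs on which [end_arc] is silent follow the enumeration. In a forbidden configuration it is not
   silent, since [x y'] and [x' y] are independent. *)
pose M := MixedGraph (fun u v => ~~ same_part u v && ~~ adj u v)
  (fun u v => [&& u != v, same_part u v &
     end_arc A u v || ~~ end_arc A v u && (enum_rank u < enum_rank v)]).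
exists M; split; first split=> //=; first split=> [u v|u v neq_uv uv].
- by case/and3P=> -> ->.
- have vu : same_part v u by rewrite same_partE eq_sym -same_partE.
  rewrite neq_uv uv eq_sym neq_uv vu /=.
  case: (boolP (end_arc A u v)) => [/asym->|_] //=.
  case: (end_arc A v u) => //=.
  have : enum_rank u != enum_rank v by rewrite (inj_eq enum_rank_inj).
  by rewrite -val_eqE /=; case: ltngtP.
case=> x [x' [y [y' [[xX x'X yY y'Y] nxy nx'y' [xy' x'y] /= []]]]].
case/and3P=> _ _ xx' /and3P[_ _ yy'].
have [e [xe ye]] := edge_of_adj xy' xX; have [f [xf yf]] := edge_of_adj x'y x'X.
have : I_graph e f by rewrite I_graphE xe ye xf yf nxy nx'y'.
rewrite (proj1 orA) => /orP[ef|fe].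
  have y'y : end_arc A y' y by apply/end_arcP; exists e, f; split=> //; right.
  by move: yy'; rewrite y'y (asym _ _ y'y).
have xx'A : end_arc A x' x by apply/end_arcP; exists f, e; split=> //; left.
by move: xx'; rewrite xx'A (asym _ _ xx'A).
Qed.

(** The arcs [u -> v] and [v' -> u'] with the edges [u u'] and [v v'] would form the forbidden
    configuration. *)
Lemma T_free_arc_step (M : mixed_graph G) u v u' v' :
  complement_orientation M -> T_free M -> same_part u v ->
  pair_step (u, v) (u', v') -> Defs.arc M u v -> Defs.arc M u' v'.
Proof.
case=> _ [_ tour] free uv /and4P[/= uu' vv' nuv' nvu'] arc_uv.
have uv' := same_part_step uu' vv' uv.
have ne_uv' : u' != v' by apply: contraNneq nuv' => <-.
apply/negPn/negP => /negPf narc; apply: free.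
have := tour _ _ ne_uv' uv'; rewrite narc /= => arc_vu'.
move: (uv); rewrite same_partE => /eqP uvX.
case: (boolP (u \in partX G)) => uX.
  exists u, v, v', u'; split=> //; rewrite ?partYE.
  by rewrite (adj_partX uu') (adj_partX vv') -uvX uX.
exists v', u', u, v; split=> //; rewrite ?partYE.
- by rewrite (adj_partX uu') (adj_partX vv') -uvX uX.
- by rewrite adj_sym.
- by rewrite adj_sym.
- by rewrite adj_sym vv' adj_sym uu'.
Qed.

Lemma pair_step_of_independent u u' v v' :
  adj u u' -> adj v v' -> independent u u' v v' -> pair_step (u, v) (u', v').
Proof. by rewrite /pair_step /= => -> -> /and3P[_ -> ->]. Qed.

Lemma conn_of_congruent a p b q :
  congruent a p b q -> connect pair_step (a, b) (last a p, last b q).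
Proof.
case=> -[+ +] _; elim: p a b q => [|c p IHp] a b [|d q] //= /andP[ac path_p].
move=> /andP[bd path_q] [sz] ind.
have lt_q i : i < size p -> i < size q by rewrite sz.
have step := pair_step_of_independent ac bd (ind 0 isT).
apply: connect_trans (connect1 step) _.
apply: IHp => // i lt_i; have := ind i.+1 lt_i.
rewrite /= (set_nth_default c a) ?(set_nth_default c a lt_i) 1?ltnW //.
by rewrite (set_nth_default d b) ?(set_nth_default d b (lt_q i _)) //
  ltnW ?ltnS ?lt_q.
Qed.

Lemma T_free_arc_conn (M : mixed_graph G) u v u' v' :
  complement_orientation M -> T_free M -> same_part u v ->
  connect pair_step (u, v) (u', v') -> Defs.arc M u v -> Defs.arc M u' v'.
Proof.
move=> orM free + /connectP[s]; elim: s u v => [|[a b] s IHs] u v uv /=.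
  by move=> _ [-> ->].
case/andP=> step path_s last_s arc_uv; have /and4P[/= ua vb _ _] := step.
apply: IHs path_s last_s _; first exact: same_part_step uv.
exact: T_free_arc_step arc_uv.
Qed.

Lemma no_invertible_of_T_free :
  has_T_free_orientation G -> ~ has_invertible_pair G.
Proof.
move=> [M [orM free]] [u [v [ne_uv [p [q [cong last_p last_q]]]]]].
have uv : same_part u v by case: cong.
have vu : same_part v u by rewrite same_partE eq_sym -same_partE.
have := conn_of_congruent cong; rewrite last_p last_q => flip.
have [_ [_ tour]] := orM; have := tour _ _ ne_uv uv.
case: (boolP (Defs.arc M u v)) => [arc_uv|/negP narc] /=.
  by rewrite (T_free_arc_conn orM free uv flip).
move=> arc_vu; apply: narc; apply: T_free_arc_conn arc_vu => //.
exact: pair_conn_swap.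
Qed.

(** * Edge-asteroids *)

Definition opposite_pair e z := (if z \in partX G then xend e else yend e, z).

Definition apart e z := ~~ adj z (xend e) && ~~ adj z (yend e).

(** While [z] follows a walk away from [e], its partner goes to and fro along [e], congruently. *)
Lemma opposite_pair_step e z z' :
  apart e z -> apart e z' -> adj z z' ->
  pair_step (opposite_pair e z) (opposite_pair e z').
Proof.
move=> /andP[zx zy] /andP[zx' zy'] zz'; have [_ _ xy] := edgeP e.
rewrite /pair_step /= (adj_partX zz') zz'; case: ifP => _ /=.
  by rewrite xy adj_sym zx' zy.
by rewrite adj_sym xy adj_sym zy' zx.
Qed.

Lemma opposite_pair_conn e s z z' :
  is_walk (@adj G) s -> (forall w, w \in s -> apart e w) ->
  z \in s -> z' \in s ->
  connect pair_step (opposite_pair e z) (opposite_pair e z').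
Proof.
case: s => // a p path_p avoid.
have from_a t : t \in a :: p ->
    connect pair_step (opposite_pair e a) (opposite_pair e t).
  elim: p a path_p avoid => [|b p IHp] a /=.
    by move=> _ _; rewrite inE => /eqP->.
  case/andP=> ab path_p avoid; rewrite inE => /predU1P[->|tp].
    exact: connect0.
  have in_tail w : w \in b :: p -> apart e w.
    by move=> wp; apply: avoid; rewrite inE wp orbT.
  apply: connect_trans (IHp b path_p in_tail tp).
  apply/connect1/opposite_pair_step => //.
    by apply: avoid; rewrite mem_head.
  by apply: in_tail; rewrite mem_head.
move=> /from_a za /from_a; apply: connect_trans.
by rewrite (sym_connect_sym pair_step_sym).
Qed.

(** The walk for [m] connects the pair of index [m] with the reverse of the pair of index
    [m + k + 1]. Two such flips shift the index by [2k + 2], that is by one, so all pairs and their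
    reverses are connected. *)
Lemma invertible_of_weak_edge_asteroid :
  has_weak_edge_asteroid G -> has_invertible_pair G.
Proof.
case=> k [e [k_gt0 walks]].
pose n := (2 * k).+1; pose x (m : nat) := xend (e (inZp m)).
have xn m : x (m + n) = x m.
  by congr (xend (e _)); apply/val_inj; rewrite /= modnDr.
have inZpD (m i : nat) : inZp ((inZp m : 'I_n) + i) = inZp (m + i) :> 'I_n.
  by apply/val_inj; rewrite /= modnDml.
have xX m : x m \in partX G by case: (edgeP (e (inZp m))).
have conn m : connect pair_step (x m, x (m + k)) (x m, x (m + k + 1)).
  have [s [walk_s /andP[s1 _] /andP[s2 _] avoid]] := walks (inZp m).
  move: s1 s2; rewrite -addnA !inZpD addnA => s1 s2.
  have := opposite_pair_conn walk_s avoid s1 s2.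
  by rewrite /opposite_pair -!/(x _) !xX.
have flip m : connect pair_step (x m, x (m + k))
    (x (m + k + 1 + k), x (m + k + 1)).
  have -> : m + k + 1 + k = m + n by rewrite /n; lia.
  by rewrite xn.
have next m : connect pair_step (x m, x (m + k)) (x m.+1, x (m.+1 + k)).
  apply: connect_trans (flip m) _.
  apply: connect_trans (pair_conn_swap (flip _)) _.
  have -> : m + k + 1 + k + 1 = m.+1 + n by rewrite /n; lia.
  by rewrite -addnA (addnC n) addnA !xn.
have all_conn m : connect pair_step (x 0, x (0 + k)) (x m, x (m + k)).
  by elim: m => [|m IHm]; [apply: connect0 | apply: connect_trans IHm (next m)].
exists (x 0), (x k).
have xx : same_part (x 0) (x k) by rewrite same_partE !xX.
split; last first.
  apply: congruent_of_conn xx _; rewrite -{1}[k]add0n.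
  apply: connect_trans (all_conn (0 + k + 1)) _.
  by rewrite (sym_connect_sym pair_step_sym); apply: pair_conn_swap (flip 0).
(* The walk for [e 0] contains [x k], which is therefore not adjacent to the Y-end of [e 0], while
   [x 0] is. *)
have [s [_ /andP[s1 _] _ avoid]] := walks (inZp 0).
move: s1; rewrite inZpD => /avoid/andP[_]; apply: contraNneq => eq_x.
by rewrite -/(x _) add0n -eq_x; case: (edgeP (e (inZp 0))).
Qed.

(** Dependent edges have the X-end of one adjacent to the Y-end of the other. The walk traverses [e]
    and crosses to [f], first going back to [xend e] if the crossing leaves from there. *)
Lemma walk_of_edge_path (B : pred G) e p :
  path (complement (@I_graph G)) e p ->
  (forall f, f \in e :: p -> B (xend f) && B (yend f)) ->
  exists s, [/\ path (@adj G) (xend e) s, yend e \in s,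
    xend (last e p) \in xend e :: s,
    yend (last e p) \in s & all B (xend e :: s)].
Proof.
elim: p e => [|f p IHp] e /= => [_ inB|/andP[/andP[_ nI] path_p] inB].
  have /andP[Bx By] := inB e (mem_head _ _).
  exists [:: yend e]; rewrite /= !inE !eqxx Bx By !andbT.
  by split=> //; case: (edgeP e).
have /andP[Bx By] := inB e (mem_head _ _).
have inB' g : g \in f :: p -> B (xend g) && B (yend g).
  by move=> gp; apply: inB; rewrite inE gp orbT.
have [s [path_s ys xl yl Bs]] := IHp f path_p inB'.
have [_ _ ae] := edgeP e; have [_ _ af] := edgeP f.
have /andP[Bxf Byf] := inB' f (mem_head _ _).
move: nI; rewrite I_graphE negb_and !negbK => /orP[ef|fe].
  exists [:: yend e, xend e, yend f, xend f & s].
  rewrite /= ae adj_sym ae ef adj_sym af path_s !inE eqxx.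
  move: Bs xl; rewrite /= inE => /andP[_ ->]; rewrite Bx By Bxf Byf.
  by move=> /orP[->|->]; rewrite yl ?orbT.
exists [:: yend e, xend f & s].
rewrite /= ae adj_sym fe path_s !inE eqxx.
move: Bs xl; rewrite /= inE => /andP[_ ->]; rewrite Bx By Bxf.
by move=> /orP[->|->]; rewrite yl ?orbT.
Qed.

Lemma edge_asteroid_of_asteroid :
  has_asteroid (complement (@I_graph G)) -> has_edge_asteroid G.
Proof.
case=> k [e [k_gt0 e_inj paths]]; exists k, e; split=> //; split=> // i.
have [[|f p] [/and4P[//= path_p _ /eqP head_p /eqP last_p] avoid]] := paths i.
(* An asteroid path avoids the neighbours of [e i] but not explicitly [e i]; starting elsewhere, it
   could reach [e i] only through a neighbour. *)
have neq_e : inZp (i + k) != i.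
  apply/eqP => /(congr1 val) /= eq_i; have lt_i := ltn_ord i.
  case: (ltnP (i + k) (2 * k).+1) => [lt_ik|le_ik].
    by move: eq_i; rewrite modn_small //; lia.
  have eq_ik : i + k = (i + k - (2 * k).+1) + (2 * k).+1 by rewrite subnK.
  by move: eq_i; rewrite eq_ik modnDr modn_small; lia.
have I_path g : g \in f :: p -> I_graph (e i) g.
  have: f != e i by rewrite head_p (inj_eq e_inj).
  elim: p f path_p avoid {head_p last_p} => [|h p IHp] f /= path_p avoid ne_f.
    rewrite inE => /eqP->; have := avoid f (mem_head _ _).
    by rewrite /complement eq_sym ne_f negbK.
  have If : I_graph (e i) f.
    by have := avoid f (mem_head _ _); rewrite /complement eq_sym ne_f negbK.
  rewrite inE => /predU1P[->//|]; case/andP: path_p => /andP[_ nfh] path_p.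
  apply: IHp => // [w wp|]; first by apply: avoid; rewrite inE wp orbT.
  by apply: contraNneq nfh => ->; rewrite I_graph_sym.
have far g : g \in f :: p -> apart (e i) (xend g) && apart (e i) (yend g).
  move/I_path; rewrite I_graphE => /andP[nxy nyx].
  have [xi yi _] := edgeP (e i); have [xg yg _] := edgeP g.
  rewrite /apart nyx [adj (yend g) (xend _)]adj_sym nxy.
  by rewrite !same_part_nadj // same_partE ?xi ?xg ?(negPf yi) ?(negPf yg).
have [s [path_s ys xl yl As]] := walk_of_edge_path path_p far.
exists (xend f :: s); split=> //.
- by rewrite -head_p mem_head inE ys orbT.
- by rewrite -last_p xl inE yl orbT.
by move=> w ws; apply: (allP As).
Qed.

End BipartiteGraph.

Theorem theorem2p6 (G : bigraph) :
  [<-> comparability_graph (@I_graph G);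
       has_T_free_orientation G;
       ~ has_invertible_pair G;
       ~ has_weak_edge_asteroid G;
       ~ has_edge_asteroid G;
       ~ has_asteroid (complement (@I_graph G))].
Proof.
tfae.
- exact: T_free_of_comparability.
- exact: no_invertible_of_T_free.
- by move=> no_inv /invertible_of_weak_edge_asteroid.
- by move=> no_weak [k [e [weak _]]]; apply: no_weak; exists k, e.
- by move=> no_edge /edge_asteroid_of_asteroid.
move=> no_asteroid; apply: comparability_of_no_flip => [|e f].
  exact: I_graph_sym.
apply: no_flip_of_no_asteroid no_asteroid.
  exact: I_graph_sym.
exact: I_graph_irr.
Qed.
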